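(* Suppose that the stochastic dynamical system $(X_n^x)$ is generated by contractions, i.e. $\tilde\mu$ is supported by $\mathfrak L_1$, and that it is conservative. Then it is strongly contractive if and only if $\mathfrak S(\tilde\mu)\subset\mathfrak L_1$ contains a constant function.
   Context: Let $(\mathsf X,d)$ be a proper metric space (closed balls are compact), and let $\mathfrak G$ be the monoid of all continuous maps $\mathsf X\to\mathsf X$ with the topology of uniform convergence on compact sets. Let $\tilde\mu$ be a regular probability measure on $\mathfrak G$ and $(F_n)_{n\ge1}$ i.i.d. $\mathfrak G$-valued random variables with distribution $\tilde\mu$, defined on a probability space $(\Omega,\mathfrak A,\mathrm{Pr})$. The stochastic dynamical system (SDS) is $X_0^x=x\in\mathsf X$, $X_n^x=F_n(X_{n-1}^x)$, $n\ge1$. $\mathfrak L_1\subset\mathfrak G$ is the closed submonoid of all maps $f:\mathsf X\to\mathsf X$ with Lipschitz constant $\le1$ (called contractions). $\mathfrak S(\tilde\mu)$ is the closed sub-semigroup of $\mathfrak L_1$ generated by $\mathrm{supp}(\tilde\mu)$. The SDS is conservative if $\mathrm{Pr}[\liminf_n d(X_n^x,x)<\infty]=1$ for every $x\in\mathsf X$. It is strongly contractive if for every $x\in\mathsf X$, $\mathrm{Pr}[d(X_n^x,X_n^y)\to0\text{ for all }y\in\mathsf X]=1$. *)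

(* Defs.v *)
From HB Require Import structures.
From mathcomp Require Import all_boot all_order all_algebra finmap.
From mathcomp Require Import all_classical all_reals all_analysis.

Set Implicit Arguments.
Unset Strict Implicit.
Unset Printing Implicit Defensive.

Import Order.TTheory GRing.Theory Num.Theory.
Import numFieldNormedType.Exports.

Local Open Scope classical_set_scope.
Local Open Scope ring_scope.

(* The library's [closed_ball] is the closure of the open ball, which may be
   strictly smaller than the closed ball used here. *)
Definition proper_space (R : realType) (X : metricType R) : Prop :=
  forall (x : X) (r : R), compact [set y | mdist x y <= r].

(* The monoid of continuous self-maps. [continuousType X X] carries no
   canonical topology in the library; this alias is given the one induced by
   the topology of uniform convergence on compact sets. *)
Definition cmap (X : uniformType) : Type := continuousType X X.

Definition cmap_fun (X : uniformType) (f : cmap X) : X -> X :=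
  (f : continuousType X X).
Coercion cmap_fun : cmap >-> Funclass.

HB.instance Definition _ (X : uniformType) :=
  Topological.copy (cmap X)
    (initial_topology
      ((fun f => f) : continuousType X X -> {family compact, X -> X})).

HB.instance Definition _ (X : uniformType) :=
  isPointed.Build (cmap X) [the continuousType X X of idfun].

Definition cmap_comp (X : uniformType) (f g : cmap X) : cmap X :=
  [the continuousType X X of
    (f : continuousType X X) \o (g : continuousType X X)].

Notation borel T := (g_sigma_algebraType (@open T)).

Definition regular_measure (R : realType) (T : ptopologicalType)
    (mu : probability (borel T) R) : Prop :=
  forall A : set (borel T), measurable A ->
    mu A = ereal_inf [set mu U | U in [set U : set T | open U /\ A `<=` U]] /\
    mu A = ereal_sup [set mu K | K in [set K : set T |
             [/\ compact K, measurable (K : set (borel T)) & K `<=` A]]].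

Definition supp (R : realType) (T : ptopologicalType)
    (mu : probability (borel T) R) : set T :=
  [set f | forall U : set T, open U -> U f -> (0 < mu U)%E].

Section contractions.
Context (R : realType) (X : metricType R).

Definition L1 : set (cmap X) :=
  [set f | forall x y, mdist (f x) (f y) <= mdist x y].

(* As [L1] is closed, closedness in [L1] and in [cmap X] agree. *)
Definition closed_subsemigroup (S : set (cmap X)) : Prop :=
  [/\ S `<=` L1, closed S & forall f g, S f -> S g -> S (cmap_comp f g)].

Definition generated_semigroup (mu : probability (borel (cmap X)) R) :
    set (cmap X) :=
  smallest closed_subsemigroup (supp mu).

(* No point of [X] is named, so that the empty space needs no exclusion. *)
Definition constant_map (f : cmap X) : Prop := forall x y : X, f x = f y.

End contractions.

Section iid.
Context d (Omega : measurableType d) d' (T : measurableType d') (R : realType).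
Variables (P : probability Omega R) (F : nat -> {RV P >-> T}).

Definition mutually_independent : Prop :=
  forall (J : {fset nat}) (A : nat -> set T),
    (forall i, i \in J -> measurable (A i)) ->
    P (\bigcap_(i in [set` J]) (F i @^-1` A i)) =
    (\prod_(i <- J) P (F i @^-1` A i))%E.

Definition iid (mu : probability T R) : Prop :=
  mutually_independent /\
  forall n (A : set T), measurable A -> distribution P (F n) A = mu A.

End iid.

Section sds.
Context (R : realType) (X : metricType R) d (Omega : measurableType d).
Variables (P : probability Omega R) (F : nat -> {RV P >-> borel (cmap X)}).

(* [F n] is the (n+1)-st random map. *)
Fixpoint sds (x : X) (n : nat) (w : Omega) : X :=
  if n is m.+1 then cmap_fun (F m w) (sds x m w) else x.

Definition conservative : Prop :=
  forall x : X, {ae P, forall w,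
    (limn_einf (fun n => (mdist (sds x n w) x)%:E) < +oo)%E}.

(* The event below, a possibly uncountable intersection over [y], need not be
   measurable for general continuous maps, hence "almost surely" rather than
   the value of [P] at this set. *)
Definition strongly_contractive : Prop :=
  forall x : X, {ae P, forall w, forall y : X,
    mdist (sds x n w) (sds y n w) @[n --> \oo] --> (0 : R)}.

End sds.

(* Main.v *)
(* If the system is strongly contractive, take a sample path along which X_n^x
   returns infinitely often to a ball. By properness the points X_n^x
   accumulate at some z along the return times, and since all trajectories
   merge, the contractions F_n o ... o F_1 accumulate, uniformly on compact
   sets, at the constant map z.

   Conversely, a constant map in the semigroup is approximated on a compact
   ball K by products of maps from open sets U_1, ..., U_N of positive measure.
   At each visit of X_n^x to a smaller ball, the next N maps fall into
   U_1, ..., U_N with a fixed positive probability, independently of the past,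
   and then bring X^x and X^y within e of each other. The visits being
   infinitely many, almost surely one attempt succeeds, and the distance never
   increases again. Since the maps are contractions, it suffices to treat y in
   a countable dense set. *)
Require Import Defs.
From HB Require Import structures.
From mathcomp Require Import all_boot all_order all_algebra finmap.
From mathcomp Require Import all_classical all_reals all_analysis.
From mathcomp Require Import lra zify.

Set Implicit Arguments.
Unset Strict Implicit.
Unset Printing Implicit Defensive.

Import Order.TTheory GRing.Theory Num.Theory.
Import numFieldNormedType.Exports.

Local Open Scope classical_set_scope.
Local Open Scope ring_scope.

(** * Uniform convergence on compact sets *)

Section compact_convergence.
Context (R : realType) (X : metricType R).
Implicit Types (f g h : cmap X) (K : set X).

Lemma cmap_nbhs f K (e : R) : compact K -> 0 < e ->
  nbhs f [set g : cmap X | forall u, K u -> mdist (f u) (g u) < e].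
Proof.
move=> cK e0.
have : {family compact,
    (fun g : cmap X => g : X -> X) @ nbhs f --> (f : X -> X)}.
  exact: (@initial_continuous (continuousType X X) {family compact, X -> X}
    (fun f => f) f).
move=> /fam_cvgP-/(_ K cK) cv.
apply: (cv [set g : X -> X | forall u, K u -> mdist (f u) (g u) < e]).
apply/uniform_nbhs.
exists [set xy | ball xy.1 e xy.2]; split.
  by rewrite -entourage_ballE; exists e.
by move=> g gK u Ku; have := gK u Ku; rewrite /= ballEmdist.
Qed.

Lemma cmap_cvg (F : set_system (cmap X)) f : Filter F ->
  (forall K (e : R), compact K -> 0 < e ->
    F [set g : cmap X | forall u, K u -> mdist (f u) (g u) < e]) ->
  F --> f.
Proof.
move=> FF FK A /= [_ [[B Bop <-] Bf sBA]].
apply: filterS sBA _.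
have : nbhs ((fun f => f) f : {family compact, X -> X}) B.
  by rewrite nbhsE; exists B.
suff : {family compact,
    ((fun f : cmap X => (f : X -> X)) @ F) --> (f : X -> X)}.
  by apply.
apply/fam_cvgP => K cK U /= /uniform_nbhs[E [+ EU]].
rewrite -entourage_ballE => -[e /= e0 eE].
apply: filterS (FK K e cK e0) => g gK; apply: EU => u Ku.
by apply: eE => /=; rewrite ballEmdist /=; exact: gK.
Qed.

Lemma eval_nbhs f (x : X) (e : R) : 0 < e ->
  nbhs f [set g : cmap X | mdist (f x) (g x) < e].
Proof.
move=> e0; apply: filterS (cmap_nbhs f (@compact_set1 _ x) e0).
by move=> g; apply.
Qed.

Lemma open_eval_ball (x a : X) (c : R) :
  open [set f : cmap X | mdist (f x) a < c].
Proof.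
rewrite openE => f /= fc.
have c0 : 0 < c - mdist (f x) a by rewrite subr_gt0.
apply: filterS (eval_nbhs f x c0) => g /= gf.
rewrite (le_lt_trans (metric_triangle _ (f x) _)) // metric_sym.
by rewrite -ltrBrDr.
Qed.

Lemma L1_closed : closed (@L1 R X).
Proof.
move=> f clf x y; apply/ler_addgt0Pl => e e0.
have e2 : 0 < e / 2 by rewrite divr_gt0.
have [g [gL1 [/= gx gy]]] :=
  clf _ (filterI (eval_nbhs f x e2) (eval_nbhs f y e2)).
apply: le_trans (metric_triangle _ (g x) _) _.
have := metric_triangle (g x) (g y) (f y).
move: gx gy (gL1 x y); rewrite (metric_sym (g y)) => *; lra.
Qed.

Lemma L1_comp f g : L1 f -> L1 g -> L1 (cmap_comp f g).
Proof. by move=> fL gL x y; exact: le_trans (fL _ _) (gL _ _). Qed.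

(** Contractions are equicontinuous: closeness at [x] extends, by three [e / 3] estimates, to a
    neighbourhood of [x], and compactness of [K] makes this uniform. *)
Lemma L1_cvg_pointwise (F : set_system (cmap X)) f : Filter F ->
  F (@L1 R X) -> L1 f -> (forall x (e : R), 0 < e ->
    F [set g : cmap X | mdist (f x) (g x) < e]) -> F --> f.
Proof.
move=> FF FL1 fL Fx; apply: cmap_cvg => K e cK e0.
have e3 : 0 < e / 3 by rewrite divr_gt0.
have /compact_near_coveringP cov := cK.
apply: (cov (cmap X) F (fun g u => mdist (f u) (g u) < e)) => x Kx.
near=> y g.
have gL : L1 g by near: g.
have xy : mdist x y < e / 3.
  near: y; have := nbhsx_ballx x _ e3; rewrite ballEmdist; exact.
have gx : mdist (f x) (g x) < e / 3 by near: g; exact: Fx.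
have := fL y x; have := gL x y.
have := metric_triangle (f y) (f x) (g y).
have := metric_triangle (f x) (g x) (g y).
rewrite (metric_sym y); lra.
Unshelve. all: by end_near. Qed.

End compact_convergence.

(** * The support of a regular measure *)

Section regular_support.
Context (R : realType) (T : ptopologicalType) (mu : probability (borel T) R).

Lemma open_measurable_borel (U : set T) :
  open U -> measurable (U : set (borel T)).
Proof. exact: sub_gen_smallest. Qed.

Lemma closed_measurable_borel (U : set T) :
  closed U -> measurable (U : set (borel T)).
Proof.
move=> /closed_openC/open_measurable_borel/measurableC; rewrite setCK; exact.
Qed.

Lemma closed_supp : closed (supp mu).
Proof.
rewrite -[supp mu]setCK; apply: open_closedC; rewrite openE => f /= nf.
have [U [oU Uf mU]] : exists U : set T, [/\ open U, U f & mu U = 0%E].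
  apply: contrapT => nU; apply: nf => U oU Uf.
  by rewrite lt0e measure_ge0 andbT; apply/eqP => U0; apply: nU; exists U.
apply: (@filterS _ _ _ U); last exact: open_nbhs_nbhs.
by move=> g Ug /(_ U oU Ug); rewrite mU ltxx.
Qed.

Hypothesis regular_mu : regular_measure mu.

(** By inner regularity it suffices to treat compact subsets of the complement, and each of these is
    covered by finitely many null open sets. *)
Lemma supp_conull : mu (~` supp mu) = 0%E.
Proof.
have mS : measurable (~` supp mu : set (borel T)).
  by apply: measurableC; apply: closed_measurable_borel; exact: closed_supp.
have [_ ->] := regular_mu mS.
apply/eqP; rewrite eq_le; apply/andP; split; last first.
  apply: ereal_sup_ubound; exists set0; last exact: measure0.
  by split; [exact: compact0|exact: measurable0|exact: sub0set].
apply: ge_ereal_sup => _ [K [cK mK KS] <-]; rewrite measure_le0.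
move: cK; rewrite compact_cover => cK.
have [U UD KU] :
    finite_subset_cover [set U : set T | open U /\ mu U = 0%E] id K.
  apply: cK => [U []//|f /KS nf]; apply: contrapT => nU; apply: nf => U oU Uf.
  rewrite lt0e measure_ge0 andbT; apply/eqP => U0; apply: nU.
  by exists U.
have UN : mu.-negligible (\bigcup_(i in [set` U]) i : set (borel T)).
  rewrite bigcup_fset big_seq; apply: big_ind => [|A B|V /UD/set_mem/=[oV V0]].
  - exact: (@negligible_set0 _ (borel T)).
  - exact: (@negligibleU _ (borel T)).
  - by apply/(@negligibleP _ (borel T)) => //; exact: open_measurable_borel.
apply/eqP/(measure_negligible mK).
exact: (@negligibleS _ (borel T) R mu _ K KU UN).
Qed.

End regular_support.

(** * A constant map as a limit of merging trajectories *)

Section constant_limit.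
Context (R : realType) (X : metricType R).
Hypothesis properX : proper_space X.

(** An ultrafilter on the return times replaces the choice of a subsequence. Along it [g k x]
    converges to some [z], hence so does [g k y] for every [y], and for contractions pointwise
    convergence is enough. *)
Lemma constant_in_closure (S : set (cmap X)) (g : nat -> cmap X) (x : X)
    (r : R) :
  closed S -> S `<=` @L1 R X -> (forall n, S (g n)) ->
  (forall n, exists2 k, (n <= k)%N & mdist (g k x) x < r) ->
  (forall y, mdist (g n x) (g n y) @[n --> \oo] --> (0 : R)) ->
  exists2 f : cmap X, S f & constant_map f.
Proof.
move=> cS SL gS rec contr.
pose I := [set k | mdist (g k x) x < r].
have pF0 : ProperFilter (within I \oo).
  split=> [[n _ nI]|]; last exact: within_filter.
  by have [k nk kr] := rec n; exact: (nI k nk).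
have [G [UG F0G]] := ultraFilterLemma pF0.
have GI : G I by apply: F0G; exact: withinT.
have Goo : \oo `<=` G by move=> A Aoo; apply: F0G; apply: filterS Aoo => k Ak _.
have Gr : G [set k | mdist x (g k x) <= r].
  by apply: filterS GI => k; rewrite /I /= metric_sym => /ltW.
have [z [_ clz]] := @properX x r (g k x @[k --> G]) _ Gr.
pose f : cmap X :=
  [the continuousType X X of mkcts (@cst_continuous X X z)].
have GL : G [set k | L1 (g k)] by apply: filterE => k; exact/SL/gS.
have Gz (e : R) : 0 < e -> G [set k | mdist z (g k x) < e].
  (* A cluster point of an ultrafilter is a limit: otherwise the complementary set would belong to
     [G] and would have to meet the ball around [z]. *)
  move=> e0; have [//|Gn] := in_ultra_setVsetC [set k | mdist z (g k x) < e] UG.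
  have zz : nbhs z [set y | mdist z y < e].
    by rewrite -ballEmdist; exact: nbhsx_ballx.
  have [y [/= + yz]] := clz [set y | ~ mdist z y < e] _ Gn zz.
  by [].
have gf : g k @[k --> G] --> f.
  apply: L1_cvg_pointwise => // [a b|y e e0].
    by rewrite mdistxx mdist_ge0.
  have e2 : 0 < e / 2 by rewrite divr_gt0.
  have Gy : G [set k | `|mdist (g k x) (g k y)| < e / 2].
    by apply: Goo; move/cvgr0Pnorm_lt : (contr y); exact.
  suff : G [set k | mdist z (g k y) < e] by [].
  apply: filterS2 (Gz _ e2) Gy => k /= zk; rewrite ger0_norm ?mdist_ge0// => ky.
  have := metric_triangle z (g k x) (g k y); rewrite /f /=; lra.
exists f => //; apply: cS => B /gf GB.
have [k Bk] : exists k, B (g k) by apply: (@filter_ex _ G); exact: GB.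
by exists (g k); split => //; exact: gS.
Qed.

End constant_limit.

(** * A countable dense set in a proper space *)

Section nets.
Context (R : realType) (X : metricType R).
Hypothesis properX : proper_space X.

(** The compact ball of radius [m] about [x0] has a finite net of mesh [1/(k+1)]; the nets for all
    [m] and [k] are enumerated together. *)
Lemma proper_dense_seq (x0 : X) :
  exists q : nat -> X, forall y (e : R), 0 < e -> exists i, mdist y (q i) < e.
Proof.
have net m k : exists s : seq X, forall y, mdist x0 y <= m%:R ->
    exists2 a, a \in s & mdist y a < k.+1%:R^-1.
  have cK : compact [set y | mdist x0 y <= m%:R] by exact: properX.
  (* Finite sequences are directed by inclusion. A net exists near each point, so by compactness one
     sequence serves the whole ball. *)
  pose F : set_system (seq X) :=
    filter_from setT (fun s0 : seq X => [set s : seq X | {subset s0 <= s}]).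
  have FF : Filter F.
    apply: filter_from_filter; first by exists [::].
    move=> s1 s2 _ _; exists (s1 ++ s2) => // s sP.
    by split=> a sa; apply: sP; rewrite mem_cat sa ?orbT.
  have /compact_near_coveringP cov := cK.
  have [|s0 _ s0K] := cov (seq X) F
      (fun s y => exists2 a, a \in s & mdist y a < k.+1%:R^-1) FF.
    move=> y _; exists (ball y k.+1%:R^-1, [set s : seq X | y \in s]).
      split; first exact: nbhsx_ballx.
      by exists [:: y] => // s; apply; rewrite inE.
    by move=> [b s] /= []; rewrite ballEmdist /= metric_sym; exists y.
  by exists s0 => y; exact: s0K.
have /choice[s sP] : forall mk : nat * nat, exists s : seq X, forall y,
    mdist x0 y <= mk.1%:R -> exists2 a, a \in s & mdist y a < mk.2.+1%:R^-1.
  by case=> m k; exact: net.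
(* An index encodes [m], [k] and a position in the net; [x0] is the default for numbers that encode
   nothing and positions past the end. *)
exists (fun i =>
  if choice.unpickle i is Some (mk, j) then nth x0 (s mk) j else x0).
move=> y e e0.
pose m := (Num.truncn (mdist x0 y)).+1; pose k := Num.truncn e^-1.
have [|a sa ya] := sP (m, k) y; first by rewrite /= ltW // truncnS_gt.
exists (choice.pickle ((m, k), index a (s (m, k)))).
rewrite choice.pickleK nth_index //.
apply: lt_le_trans ya _; rewrite /= -[leRHS]invrK lef_pV2 ?posrE ?invr_gt0//.
by rewrite ltW // truncnS_gt.
Qed.

End nets.

(** * Independence of the past and the next maps *)

Section independence.
Context d (Omega : measurableType d) d' (T : measurableType d') (R : realType).
Context (P : probability Omega R) (F : nat -> {RV P >-> T}).
Implicit Types (A : nat -> set T) (n N : nat).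

Definition cylinder n A : set Omega :=
  [set w | forall i, (i < n)%N -> A i (F i w)].

(** This is the sigma-algebra of the first [n] maps, presented through a generating family that is
    stable under intersection. *)
Definition past n : set (set Omega) :=
  <<s [set cylinder n A | A in [set A | forall i, measurable (A i)]] >>.

Lemma cylinderS n A :
  cylinder n.+1 A = cylinder n A `&` F n @^-1` A n.
Proof.
apply/seteqP; split=> [w wA|w [wA wn] i].
  by split=> [i /ltnW ni|]; exact: wA.
by rewrite ltnS leq_eqVlt => /predU1P[->//|]; exact: wA.
Qed.

Lemma measurable_cylinder n A : (forall i, measurable (A i)) ->
  measurable (cylinder n A).
Proof.
move=> mA; elim: n => [|n IHn].
  by rewrite (_ : cylinder 0 A = setT) //; apply/seteqP; split.
rewrite cylinderS; apply: measurableI => //.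
by rewrite -[X in measurable X]setTI; exact: measurable_funPT.
Qed.

Lemma past_sigma_algebra n : sigma_algebra setT (past n).
Proof. exact: smallest_sigma_algebra. Qed.

Lemma past_cylinder n m A : (n <= m)%N -> (forall i, measurable (A i)) ->
  past m (cylinder n A).
Proof.
move=> nm mA; apply: sub_gen_smallest.
exists (fun i => if (i < n)%N then A i else setT); first by move=> i; case: ifP.
apply/seteqP; split=> w wA i ilt; last by case: ifP => // /wA.
by have := wA i (leq_trans ilt nm); rewrite ilt.
Qed.

Lemma past_preimage n i (B : set T) : (i < n)%N -> measurable B ->
  past n (F i @^-1` B).
Proof.
move=> ilt mB.
pose A j := if j == i then B else setT.
have -> : F i @^-1` B = cylinder i.+1 A.
  apply/seteqP; split=> [w wB j _|w /(_ i (ltnSn i))]; last by rewrite /A eqxx.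
  by rewrite /A; case: eqP => // ->.
by apply: past_cylinder => // j; rewrite /A; case: ifP.
Qed.

Lemma past_mono n m : (n <= m)%N -> past n `<=` past m.
Proof.
move=> nm; apply: smallest_sub; first exact: past_sigma_algebra.
by move=> _ [A mA <-]; exact: past_cylinder.
Qed.

Lemma past_measurable n : past n `<=` measurable.
Proof.
apply: smallest_sub; first exact: sigma_algebra_measurable.
by move=> _ [A mA <-]; exact: measurable_cylinder.
Qed.

Lemma pastC n D : past n D -> past n (~` D).
Proof. by rewrite -setTD; have [_ + _] := past_sigma_algebra n; apply. Qed.

Lemma past0 n : past n set0.
Proof. by have [] := past_sigma_algebra n. Qed.

Lemma past_bigcup n (D : nat -> set Omega) :
  (forall i, past n (D i)) -> past n (\bigcup_i D i).
Proof. by have [_ _] := past_sigma_algebra n; apply. Qed.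

Lemma pastI n D E : past n D -> past n E -> past n (D `&` E).
Proof.
move=> nD nE; rewrite -[D]setCK -[E]setCK -setCU -bigcup2E; apply: pastC.
apply: past_bigcup => -[|[|i]] /=; [exact: pastC|exact: pastC|exact: past0].
Qed.

Lemma past_bigcap n k (B : nat -> set Omega) :
  (forall l, (l < k)%N -> past n (B l)) -> past n (\bigcap_(l < k) B l).
Proof.
move=> pB; rewrite -[X in past _ X]setCK setC_bigcap bigcup_mkcond.
apply: pastC; apply: past_bigcup => l; case: ifPn => [|_]; last exact: past0.
by rewrite inE => /= lk; apply: pastC; exact: pB.
Qed.

Context (mu : probability T R) (iidF : iid F mu).

Lemma cylinderE n A : (forall i, measurable (A i)) ->
  P (cylinder n A) = (\prod_(i < n) mu (A i))%E.
Proof.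
move=> mA; have [indF disF] := iidF.
pose J := [fset i in iota 0 n]%fset.
have JE i : (i \in J) = (i < n)%N by rewrite !inE /= mem_iota.
have -> : cylinder n A = \bigcap_(i in [set` J]) (F i @^-1` A i).
  apply/seteqP; split=> w wA i; first by rewrite /= JE => /wA.
  by move=> ilt; apply: wA; rewrite /= JE.
rewrite indF // (perm_big (iota 0 n)) /=; last first.
  apply: uniq_perm; rewrite ?iota_uniq ?fset_uniq // => i.
  by rewrite JE mem_iota.
rewrite -[in RHS](big_mkord xpredT (fun i => mu (A i))) /index_iota subn0.
by apply: eq_bigr => i _; exact: disF.
Qed.

(** If [D] is a cylinder, the two events combine into one longer cylinder and the product formula
    applies. The events [D] satisfying the identity form a Dynkin system, so it extends to all of
    [past n]. *)
Lemma past_independent n N D A : past n D -> (forall i, measurable (A i)) ->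
  P (D `&` [set w | forall i, (i < N)%N -> A i (F (n + i) w)]) =
  (P D * \prod_(i < N) mu (A i))%E.
Proof.
move=> nD mA; set G := [set w | _]; set p := (\prod_(i < N) mu (A i))%E.
have cylG B : cylinder n B `&` G =
    cylinder (n + N) (fun i => if (i < n)%N then B i else A (i - n)%N).
  apply/seteqP; split=> [w [wB wA] i iN|w wBA].
    case: ifPn => [/wB//|]; rewrite -leqNgt => ni.
    by have := wA (i - n)%N; rewrite subnKC //; apply; lia.
  split=> i ilt; first by have := wBA i; rewrite ilt; apply; lia.
  have := wBA (n + i)%N; have -> : (n + i < n)%N = false by lia.
  by rewrite addKn; apply; lia.
have PcylG B : (forall i, measurable (B i)) ->
    P (cylinder n B `&` G) = (P (cylinder n B) * p)%E.
  move=> mB; rewrite cylG !cylinderE //; last by move=> i; case: ifP.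
  rewrite big_split_ord /=; congr (_ * _)%E; apply: eq_bigr => i _.
    by rewrite ltn_ord.
  by rewrite ltnNge leq_addr /= addKn.
have cylT : cylinder n (fun=> setT) = setT by apply/seteqP; split.
have mG : measurable G.
  by rewrite -[G]setTI -cylT cylG; apply: measurable_cylinder => i; case: ifP.
have GE : P G = p.
  have := PcylG (fun=> setT) (fun=> measurableT).
  by rewrite cylT setTI probability_setT mul1e.
suff : past n `<=` [set D | measurable D /\ P (D `&` G) = (P D * p)%E].
  by move=> /(_ _ nD)[].
rewrite /past -setI_closed_g_dynkin_g_sigma_algebra; last first.
  move=> _ _ [B mB <-] [C mC <-].
  exists (fun i => B i `&` C i); first by move=> i; exact: measurableI.
  apply/seteqP; split=> [w wBC|w [wB wC] i ilt]; last first.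
    by split; [exact: wB|exact: wC].
  by split=> i /wBC[].
apply: smallest_sub; last first.
  by move=> _ [B mB <-]; split; [exact: measurable_cylinder|exact: PcylG].
split.
- by split=> //; rewrite setTI probability_setT mul1e.
- move=> E [mE EG]; split; first exact: measurableC.
  have -> : P (~` E `&` G) = (P G - P (E `&` G))%E.
    rewrite setIC -setDE measureD //; last by rewrite ltey_eq fin_num_measure.
    by rewrite (setIC G).
  rewrite EG probability_setC // -GE.
  rewrite muleBl ?fin_num_measure ?fin_num_adde_defr //; first by rewrite mul1e.
- move=> E tE mE; have mEi i : measurable (E i) by have [] := mE i.
  split; first exact: bigcup_measurable.
  rewrite setI_bigcupl measure_semi_bigcup//; last first.
  - by apply: bigcup_measurable => i _; exact: measurableI.
  - exact: trivIset_setIr.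
  - by move=> i; exact: measurableI.
  rewrite measure_semi_bigcup//; last exact: bigcup_measurable.
  rewrite -GE muleC -[P G]fineK ?fin_num_measure// -nneseriesZl//.
  apply: eq_eseriesr => i _; rewrite fineK ?fin_num_measure// GE muleC.
  by have [] := mE i.
Qed.

End independence.

(** * Recurrence along progressions and repeated attempts *)

Lemma progression_recurrence (Q : nat -> Prop) M : (0 < M)%N ->
  (forall n, exists2 k, (n <= k)%N & Q k) ->
  exists j, forall n, exists2 k, (n <= k)%N & Q (k * M + j)%N.
Proof.
move=> M0 recQ; apply: contrapT => nrec.
(* Otherwise the hits in each class [j] stop before some quotient [b j]. A hit at or beyond [M]
   times the largest [b j] with [j < M] contradicts the bound of its own class. *)
have /choice[b bP] : forall j, exists n, forall k, (n <= k)%N ->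
    ~ Q (k * M + j)%N.
  move=> j; apply: contrapT => nj; apply: nrec; exists j => n.
  apply: contrapT => nk; apply: nj; exists n => k nk' Qk.
  by apply: nk; exists k.
have [m Bm Qm] := recQ ((\max_(j < M) b j) * M)%N.
apply: (bP (m %% M)%N (m %/ M)%N); last by rewrite -divn_eq.
apply: (@leq_trans (\max_(j < M) b j)); last by rewrite leq_divRL.
exact: (@leq_bigmax _ (fun j : 'I_M => b j) (Ordinal (ltn_pmod m M0))).
Qed.

Section first_success.
Context d (Omega : measurableType d) (R : realType) (P : probability Omega R).
Implicit Types (A G D : nat -> set Omega).

(* The first successes are disjoint events, so their probabilities sum to at
   most 1; dividing by [p] makes the attempts without earlier success summable,
   and the first Borel-Cantelli lemma applies. *)
Lemma attempts_until_success A G (p : R) : 0 < p ->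
  (forall k, measurable (A k)) -> (forall k, measurable (G k)) ->
  (forall k, let D := A k `&` \bigcap_(l < k) ~` (A l `&` G l) in
    P (D `&` G k) = (P D * p%:E)%E) ->
  {ae P, forall w, (forall n, exists2 k, (n <= k)%N & A k w) ->
    exists k, A k w /\ G k w}.
Proof.
move=> p0 mA mG indep.
pose D k := A k `&` \bigcap_(l < k) ~` (A l `&` G l).
have mD k : measurable (D k).
  apply: measurableI => //; apply: bigcap_measurableType => l _.
  by apply: measurableC; exact: measurableI.
have mDG k : measurable (D k `&` G k) by exact: measurableI.
have tDG : trivIset setT (fun k => D k `&` G k).
  apply/trivIsetP => i j _ _ ij; apply/seteqP; split => // w.
  move=> [[[Ai Di] Gi] [[Aj Dj] Gj]].
  have /orP[ltij|ltji] : (i < j)%N || (j < i)%N by rewrite -neq_ltn.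
    exact: (Dj i ltij).
  exact: (Di j ltji).
have sumD : (\sum_(k <oo) P (D k) < +oo)%E.
  have : (\sum_(k <oo) P (D k `&` G k) <= 1)%E.
    rewrite -measure_semi_bigcup //; last exact: bigcup_measurable.
    by apply: probability_le1; exact: bigcup_measurable.
  have -> : (\sum_(k <oo) P (D k `&` G k) = p%:E * \sum_(k <oo) P (D k))%E.
    rewrite -nneseriesZl //; apply: eq_eseriesr => k _.
    by rewrite [LHS]indep muleC.
  rewrite -lee_pdivlMl // => /le_lt_trans; apply.
  by rewrite mule1 ltry.
exists (lim_sup_set D); split.
- by apply: bigcap_measurableType => n _; apply: bigcup_measurable.
- exact: lim_sup_set_cvg0.
move=> w /not_implyP[Aw nAG] n _; have [k nk Akw] := Aw n.
by exists k => //; split=> // l _ AG; apply: nAG; exists l.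
Qed.

End first_success.

(** * Products of maps from open sets of positive measure *)

Section runs.
Context (R : realType) (X : metricType R).
Implicit Types (f g h : cmap X) (gs : nat -> cmap X) (x : X).

Fixpoint run gs n x : X :=
  if n is m.+1 then cmap_fun (gs m) (run gs m x) else x.

Lemma runD gs m n x :
  run gs (m + n) x = run (fun i => gs (m + i)%N) n (run gs m x).
Proof. by elim: n => [|n IHn]; rewrite ?addn0 // addnS /= IHn. Qed.

Lemma run_contraction gs n x y : (forall i, (i < n)%N -> L1 (gs i)) ->
  mdist (run gs n x) (run gs n y) <= mdist x y.
Proof.
elim: n => [//|n IHn] gL /=; apply: le_trans (gL n _ _ _) _ => //.
by apply: IHn => i /ltnW; exact: gL.
Qed.

Lemma run_nonincreasing gs x y m n : (forall i, L1 (gs i)) -> (m <= n)%N ->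
  mdist (run gs n x) (run gs n y) <= mdist (run gs m x) (run gs m y).
Proof.
move=> gL mn; rewrite -(subnKC mn) !runD.
by apply: run_contraction => i _.
Qed.

Context (mu : probability (borel (cmap X)) R).

(** The property is shaped to cut out a closed subsemigroup, so that it passes from the support to
    the generated semigroup by minimality. The clause [L1 (gs i)] is there because the open sets
    [U i] may contain maps that are not contractions. *)
Definition approximable h : Prop := L1 h /\
  forall (K : set X) (e : R), compact K -> 0 < e ->
  exists (N : nat) (U : nat -> set (cmap X)),
    (forall i, open (U i) /\ (0 < mu (U i))%E) /\
    forall gs, (forall i, (i < N)%N -> U i (gs i) /\ L1 (gs i)) ->
    forall u, K u -> mdist (h u) (run gs N u) <= e.

(** Closedness: products close to a map [g] near [h] are close to [h]. Composition: approximate [g]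
    on [K], then [f] on the compact image of [K] under [g]; the second block of maps is contracting
    and does not enlarge the error of the first. *)
Lemma approximable_closed_subsemigroup :
  closed_subsemigroup approximable.
Proof.
split=> [h []//|h clh|f g [fL fA] [gL gA]].
- have hL : L1 h.
    by apply: L1_closed => B /clh[g [[gL _] Bg]]; exists g.
  split=> // K e cK e0; have e2 : 0 < e / 2 by rewrite divr_gt0.
  have [g [[_ gA] gh]] := clh _ (cmap_nbhs h cK e2).
  have [N [U [Uo UA]]] := gA K _ cK e2.
  exists N, U; split=> // gs gsU u Ku.
  have := gh u Ku; have := UA gs gsU u Ku.
  have := metric_triangle (h u) (g u) (run gs N u); lra.
- split; first exact: L1_comp.
  move=> K e cK e0; have e2 : 0 < e / 2 by rewrite divr_gt0.
  have cgK : compact [set g u | u in K].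
    apply: continuous_compact => //; apply: continuous_subspaceT => u.
    exact: (@cts_fun _ _ (g : continuousType X X)).
  have [N1 [U1 [U1o U1A]]] := gA K _ cK e2.
  have [N2 [U2 [U2o U2A]]] := fA _ _ cgK e2.
  exists (N1 + N2)%N, (fun i => if (i < N1)%N then U1 i else U2 (i - N1)%N).
  split=> [i|gs gsU u Ku]; first by case: ifP.
  have gs1 i : (i < N1)%N -> U1 i (gs i) /\ L1 (gs i).
    by move=> ilt; have := gsU i; rewrite ilt; apply; lia.
  have gs2 i : (i < N2)%N -> U2 i (gs (N1 + i)%N) /\ L1 (gs (N1 + i)%N).
    move=> ilt; have := gsU (N1 + i)%N.
    have -> : (N1 + i < N1)%N = false by lia.
    by rewrite addKn; apply; lia.
  have := U1A gs gs1 u Ku.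
  have := U2A _ gs2 (g u) (ex_intro2 _ _ u Ku erefl).
  have := @run_contraction (fun i => gs (N1 + i)%N) N2 (g u) (run gs N1 u)
    (fun i ilt => (gs2 i ilt).2).
  rewrite runD.
  have := metric_triangle (f (g u)) (run (fun i => gs (N1 + i)%N) N2 (g u))
    (run (fun i => gs (N1 + i)%N) N2 (run gs N1 u)).
  rewrite /cmap_comp /=; lra.
Qed.

Lemma supp_approximable : supp mu `<=` @L1 R X -> supp mu `<=` approximable.
Proof.
move=> suppL f fmu; split; first exact: suppL.
move=> K e cK e0; have fK := cmap_nbhs f cK e0.
set V := [set g : cmap X | _] in fK.
exists 1%N, (fun=> interior V); split=> [i|gs gsU u Ku].
  by split; [exact: open_interior|apply: fmu => //; exact: open_interior].
by have [/interior_subset/(_ u Ku)/ltW] := gsU 0%N (ltnSn 0).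
Qed.

End runs.

(** * Visits to a ball and attempts to merge two trajectories *)

Section sds_recurrence.
Context (R : realType) (X : metricType R) d (Omega : measurableType d).
Context (P : probability Omega R) (F : nat -> {RV P >-> borel (cmap X)}).

Lemma sdsE x n w : sds F x n w = run (fun i => F i w) n x.
Proof. by elim: n => //= n ->. Qed.

Hypothesis properX : proper_space X.

(** The contraction clause is what allows the event to be expressed through a countable dense set,
    and so to be placed in the past. *)
Definition visit x n (a : X) (c : R) : set Omega :=
  [set w | (forall i, (i < n)%N -> L1 (F i w)) /\ mdist (sds F x n w) a < c].

(* For a contraction [f], [d(f(u), a) < c] holds iff some point [q] of a dense
   sequence and some [k] satisfy [d(u, q) < 1/(k+1)] and
   [d(f(q), a) < c - 1/(k+1)], two conditions on [u] and [f] separately. *)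
Lemma past_visit x n a c : past F n (visit x n a c).
Proof.
have [q qP] := proper_dense_seq properX x.
elim: n a c => [|n IHn] a c.
  have [xa|xa] := pselect (mdist x a < c).
    rewrite (_ : visit _ _ _ _ = setT); last by apply/seteqP; split.
    by rewrite -setC0; apply: pastC; exact: past0.
  rewrite (_ : visit _ _ _ _ = set0); first exact: past0.
  by apply/seteqP; split => // w [].
have -> : visit x n.+1 a c = \bigcup_k \bigcup_i
    (visit x n (q i) k.+1%:R^-1 `&` F n @^-1`
      (@L1 R X `&` [set f : cmap X | mdist (f (q i)) a < c - k.+1%:R^-1])).
  apply/seteqP; split=> [w [wL wc]|w [k _ [i _ [[wL wq] [/= nL fq]]]]].
    pose e := (c - mdist (sds F x n.+1 w) a) / 2.
    have e0 : 0 < e by rewrite divr_gt0 // subr_gt0.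
    pose k := Num.truncn e^-1.
    have k0 : 0 < k.+1%:R^-1 :> R by rewrite invr_gt0.
    have ke : k.+1%:R^-1 < e.
      rewrite -[ltRHS]invrK ltf_pV2 ?posrE ?invr_gt0 //.
      by rewrite truncnS_gt.
    have [i iq] := qP (sds F x n w) _ k0.
    exists k => //; exists i => //; split.
      by split=> // j /ltnW; exact: wL.
    have nL := wL n (ltnSn n); split => //=.
    have := nL (q i) (sds F x n w).
    have := metric_triangle (cmap_fun (F n w) (q i)) (sds F x n.+1 w) a.
    move: ke iq; rewrite /e (metric_sym (sds F x n w) (q i)).
    by move: (k.+1%:R^-1) => t /=; lra.
  split=> [j|].
    by rewrite ltnS leq_eqVlt => /predU1P[->//|]; exact: wL.
  have := nL (sds F x n w) (q i).
  have := metric_triangle (sds F x n.+1 w) (cmap_fun (F n w) (q i)) a.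
  move: wq fq; move: (k.+1%:R^-1) => t /=; lra.
apply: past_bigcup => k; apply: past_bigcup => i; apply: pastI.
  by apply: (past_mono (leqnSn n)); exact: IHn.
apply: past_preimage => //; apply: measurableI.
  by apply: closed_measurable_borel; exact: L1_closed.
by apply: open_measurable_borel; exact: open_eval_ball.
Qed.

Context (mu : probability (borel (cmap X)) R) (iidF : iid F mu).

(** At a visit both trajectories lie in the ball of radius [r + mdist x y] about [x], since their
    distance has not grown. A product that is [e / 2]-close to the constant map [f] on this ball
    sends both near the same point. *)
Lemma ae_eventually_close (f : cmap X) x y (r e : R) :
  approximable mu f -> constant_map f -> 0 < e ->
  {ae P, forall w, (forall i, L1 (F i w)) ->
    (forall n, exists2 k, (n <= k)%N & mdist (sds F x k w) x < r) ->
    exists n, mdist (sds F x n w) (sds F y n w) <= e}.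
Proof.
move=> [_ fA] fC e0; have e2 : 0 < e / 2 by rewrite divr_gt0.
have [N [U [Uo UA]]] := fA _ _ (@properX x (r + mdist x y)) e2.
have mU i : measurable (U i : set (borel (cmap X))).
  by apply: open_measurable_borel; have [] := Uo i.
pose p := (\prod_(i < N) mu (U i))%E.
have [p0 pfin] : (0 < p)%E /\ p \is a fin_num.
  rewrite /p; apply: (big_ind (fun z => (0 < z)%E /\ z \is a fin_num)).
  - by split; [exact: lte01|].
  - by move=> a b [a0 afin] [b0 bfin]; split; [exact: mule_gt0|exact: fin_numM].
  - by move=> i _; split; [have [] := Uo i|exact: fin_num_measure].
(* Attempt [k] uses the [N] maps from time [t j k] on, so it is over before attempt [k+1] starts.
   The spacing [N.+1] is positive even for [N = 0]. *)
pose t j k := (k * N.+1 + j)%N.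
pose A j k := visit x (t j k) x r.
pose G j k := [set w | forall i, (i < N)%N -> U i (F (t j k + i) w)].
have pA j k : past F (t j k) (A j k) by exact: past_visit.
have GE j k : G j k = \bigcap_(i < N) (F (t j k + i)%N @^-1` U i) by [].
have pG j l k : (l < k)%N -> past F (t j k) (G j l).
  move=> lk; rewrite GE; apply: past_bigcap => i iN; apply: past_preimage => //.
  have lkN : (l.+1 * N.+1 <= k * N.+1)%N by rewrite leq_mul2r lk orbT.
  by apply: leq_trans (leq_add lkN (leqnn j)); rewrite mulSn /t; lia.
have success j : {ae P, forall w, (forall n, exists2 k, (n <= k)%N & A j k w) ->
    exists k, A j k w /\ G j k w}.
  apply: (@attempts_until_success _ _ _ P (A j) (G j) (fine p)) => [|k|k|k D].
  - by rewrite fine_gt0 // p0 ltey_eq pfin.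
  - exact: past_measurable (pA j k).
  - exact: past_measurable (pG j k k.+1 (ltnSn k)).
  - rewrite fineK //; apply: (past_independent iidF) => //.
    apply: pastI; first exact: pA.
    apply: past_bigcap => l lk; apply: pastC; apply: pastI; last exact: pG.
    apply: (past_mono _ (pA j l)).
    by rewrite leq_add2r leq_mul2r ltnW ?orbT.
(* The residue [j] along which visits recur depends on the sample path, so the exceptional sets of
   all [j] are discarded at once. *)
have := ae_foralln success.
apply: filterS => w wsuccess wL wrec.
have [j jrec] := progression_recurrence (ltn0Sn N) wrec.
have [n|k [[_ kr] kU]] := wsuccess j.
  by have [k nk kr] := jrec n; exists k => //; split=> // i _; exact: wL.
set n := t j k in kr kU; exists (n + N)%N; rewrite !sdsE !(runD _ n N).
have UAn := UA (fun i => F (n + i)%N w) (fun i ilt => conj (kU i ilt) (wL _)).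
have := mdist_ge0 x y.
have nr : mdist (run (fun i => F i w) n x) x < r by rewrite -sdsE.
have : mdist (run (fun i => F i w) n x) (run (fun i => F i w) n y)
    <= mdist x y.
  by apply: run_contraction => i _; exact: wL.
move: (run _ n x) (run _ n y) nr => u v ux uv xy0.
have xu : mdist x u <= r + mdist x y by rewrite (metric_sym x u); lra.
have xv : mdist x v <= r + mdist x y.
  by have := metric_triangle x u v; rewrite (metric_sym x u); lra.
have := UAn u xu; have := UAn v xv; rewrite (fC v u).
have := metric_triangle (run (fun i => F (n + i)%N w) N u) (f u)
  (run (fun i => F (n + i)%N w) N v).
by rewrite (metric_sym _ (f u)); lra.
Qed.

Lemma ae_supp : regular_measure mu -> {ae P, forall w n, supp mu (F n w)}.
Proof.
move=> regular_mu; apply: ae_foralln => n.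
have mS : measurable (~` supp mu : set (borel (cmap X))).
  by apply: measurableC; apply: closed_measurable_borel; exact: closed_supp.
exists (F n @^-1` (~` supp mu)); split => //.
  by rewrite -[X in measurable X]setTI; exact: measurable_funPT.
have [_ disF] := iidF.
by have := disF n _ mS; rewrite (supp_conull regular_mu).
Qed.

End sds_recurrence.

(** * Recurrence from conservativity, the generated semigroup, and the equivalence *)

Lemma limn_einf_recurrent (R : realType) (u : nat -> R) :
  (limn_einf (fun n => (u n)%:E) < +oo)%E ->
  exists m : nat, forall n, exists2 k, (n <= k)%N & u k < m%:R.
Proof.
rewrite limn_einf_lim => lu.
have [m lm] : exists m : nat, (limn (einfs (fun n => (u n)%:E)) < m%:R%:E)%E.
  move: lu; case: (limn _) => [l _|//|_]; last by exists 0%N; exact: ltNyr.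
  exists (Num.truncn `|l|).+1; rewrite lte_fin.
  by apply: le_lt_trans (ler_norm l) _; exact: truncnS_gt.
exists m => n.
have := ereal_nondecreasing_cvgn (nondecreasing_einfs (fun n => (u n)%:E)).
move/cvg_lim => /(_ (@ereal_hausdorff R)) lE.
(* The lower limit is the supremum of the tail infima, so each tail infimum lies below [m]. *)
have : (einfs (fun n => (u n)%:E) n < m%:R%:E)%E.
  by apply: le_lt_trans lm; rewrite lE; apply: ereal_sup_ubound; exists n.
by move=> /ereal_inf_lt[_ /= [k nk <-]]; rewrite lte_fin; exists k.
Qed.

Section generated_semigroup.
Context (R : realType) (X : metricType R) (mu : probability (borel (cmap X)) R).
Hypothesis supp_mu : supp mu `<=` @L1 R X.

Lemma generated_semigroup_closed_subsemigroup :
  closed_subsemigroup (generated_semigroup mu).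
Proof.
split.
- apply: smallest_sub => //; split=> //; first exact: L1_closed.
  exact: L1_comp.
- by apply: closed_bigI => M [[]].
- move=> f g fS gS M MP; have [[_ _ Mcomp] _] := MP.
  by apply: Mcomp; [exact: fS|exact: gS].
Qed.

Lemma supp_generated_semigroup : supp mu `<=` generated_semigroup mu.
Proof. exact: sub_gen_smallest. Qed.

End generated_semigroup.

Theorem theorem4p2 (R : realType) (X : metricType R)
  (properX : proper_space X)
  (mu : probability (borel (cmap X)) R) (regular_mu : regular_measure mu)
  (d : measure_display) (Omega : measurableType d) (P : probability Omega R)
  (F : nat -> {RV P >-> borel (cmap X)}) (iidF : iid F mu)
  (supp_mu : supp mu `<=` @L1 R X)
  (conservativeF : conservative F) :
  strongly_contractive F <->
  exists2 f : cmap X, generated_semigroup mu f & constant_map f.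
Proof.
have suppF := ae_supp iidF regular_mu.
(* Almost sure events are nonempty, so a sample path can be picked from them. *)
have aeP : ProperFilter (almost_everywhere P).
  apply: ae_properfilter_algebraOfSetsType.
  by apply: (@lt_le_trans _ _ 1%E); rewrite ?lte01 // -(probability_setT P).
have [SL Scl Scomp] := generated_semigroup_closed_subsemigroup supp_mu.
split=> [contrF|[f Sf fC] x].
  (* On an empty space every map is vacuously constant, and any sampled map lies in the
     semigroup. *)
  have [[x _]|noX] := pselect (exists x : X, True); last first.
    have [w wS] := filter_ex suppF.
    exists (F 0%N w); first exact: supp_generated_semigroup (wS 0%N).
    by move=> a; case: noX; exists a.
  have [w [wS [wcons wcontr]]] :=
    filter_ex (filterI suppF (filterI (conservativeF x) (contrF x))).
  (* The product [g n] has [n.+1] factors: the semigroup may lack the identity, so the empty product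
     is avoided. *)
  pose g := fix g n : cmap X :=
    if n is m.+1 then cmap_comp (F n w) (g m) else F 0%N w.
  have gE n y : g n y = sds F y n.+1 w.
    by elim: n => // n IHn; exact: (congr1 (cmap_fun (F n.+1 w)) IHn).
  have gS n : generated_semigroup mu (g n).
    elim: n => [|n IHn]; first exact: supp_generated_semigroup (wS 0%N).
    by apply: Scomp => //; exact: supp_generated_semigroup (wS n.+1).
  have [m mrec] := limn_einf_recurrent wcons.
  apply: (@constant_in_closure R X properX _ g x m%:R Scl SL gS) => [n|y].
    by have [[//|k] nk km] := mrec n.+1; exists k => //; rewrite gE.
  rewrite (_ : (fun n => _) =
      (fun n => mdist (sds F x n.+1 w) (sds F y n.+1 w))).
    by have := wcontr y; rewrite -cvg_shiftS.
  by apply/funext => n; rewrite !gE.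
have fA : approximable mu f.
  apply: Sf; split; last exact: supp_approximable.
  exact: approximable_closed_subsemigroup.
have [q qP] := proper_dense_seq properX x.
(* One exceptional set serves all dense points [q i], precisions [1/(l+1)] and radii [m]; the radius
   has to vary because it depends on the sample path. *)
have close : {ae P, forall w i l m, (forall j, L1 (F j w)) ->
    (forall n, exists2 k, (n <= k)%N & mdist (sds F x k w) x < m%:R) ->
    exists n, mdist (sds F x n w) (sds F (q i) n w) <= l.+1%:R^-1}.
  apply: ae_foralln => i; apply: ae_foralln => l; apply: ae_foralln => m.
  by apply: (ae_eventually_close properX iidF _ _ _ fA fC); rewrite invr_gt0.
apply: filterS (filterI suppF (filterI (conservativeF x) close)).
move=> w [wS [wcons wclose]] y.
have wL j : L1 (F j w) by apply: supp_mu; exact: wS.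
have [m mrec] := limn_einf_recurrent wcons.
apply/cvgr0Pnorm_lt => e e0; have e2 : 0 < e / 2 by rewrite divr_gt0.
pose l := Num.truncn (e / 2)^-1.
have le : l.+1%:R^-1 < e / 2.
  by rewrite -[ltRHS]invrK ltf_pV2 ?posrE ?invr_gt0 // truncnS_gt.
(* The trajectories of [y] and [q i] stay within [e / 2] at all times, those of [x] and [q i] within
   [1/(l+1) < e / 2] from time [n0] on. *)
have [i yi] := qP y _ e2.
have [n0 n0le] := wclose i l m wL mrec.
exists n0 => // n /= n0n; rewrite ger0_norm ?mdist_ge0 //.
have := metric_triangle (sds F x n w) (sds F (q i) n w) (sds F y n w).
have : mdist (sds F (q i) n w) (sds F y n w) <= mdist (q i) y.
  by rewrite !sdsE; exact: run_contraction.
have : mdist (sds F x n w) (sds F (q i) n w) <= l.+1%:R^-1.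
  by apply: le_trans n0le; rewrite !sdsE; exact: run_nonincreasing.
move: le yi; rewrite (metric_sym y); move: (l.+1%:R^-1) => s; lra.
Qed.
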